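(* Let $\mathcal{Q}$ be a smooth manifold, let $H$ be a smooth real-valued function on $\mathcal{T}^*\mathcal{Q}=T^*\mathcal{Q}\times\mathbb{R}$ with contact Hamiltonian vector field $X_H$, and let $\gamma:\mathcal{Q}\times\mathbb{R}\to\mathcal{T}^*\mathcal{Q}$ be a section of $\rho:\mathcal{T}^*\mathcal{Q}\to\mathcal{Q}\times\mathbb{R}$ of the form $\gamma(q,z)=(\hat\gamma(q),z)$, where $\hat\gamma$ is a closed one-form on $\mathcal{Q}$. Define the vector field $X_H^\gamma:=T\rho\circ X_H\circ\gamma$ on $\mathcal{Q}\times\mathbb{R}$. Then the following two conditions are equivalent: 1. The vector fields $X_H$ and $X_H^\gamma$ are $\gamma$-related, that is, $T\gamma\circ X_H^\gamma=X_H\circ\gamma$, where $T\gamma:T(\mathcal{Q}\times\mathbb{R})\to T\mathcal{T}^*\mathcal{Q}$ is the tangent map of $\gamma$. 2. The equation $d(H\circ\gamma)=\gamma^*\big(\mathcal{R}(H)\,\eta_{\mathcal{Q}}\big)$ holds, where $\mathcal{R}$ is the Reeb field.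
   Context: The extended cotangent bundle $\mathcal{T}^*\mathcal{Q}=T^*\mathcal{Q}\times\mathbb{R}$ carries the contact form $\eta_{\mathcal{Q}}=dz-\theta_{\mathcal{Q}}$, where $\theta_{\mathcal{Q}}$ is the (pulled-back) canonical one-form of $T^*\mathcal{Q}$ and $z$ is the coordinate on $\mathbb{R}$. In Darboux coordinates $(q^i,p_i,z)$, $\eta_{\mathcal{Q}}=dz-p_i\,dq^i$ and the Reeb field, determined by $\iota_{\mathcal{R}}\eta_{\mathcal{Q}}=1$, $\iota_{\mathcal{R}}d\eta_{\mathcal{Q}}=0$, is $\mathcal{R}=\partial/\partial z$; $\mathcal{R}(H)$ is the directional derivative of $H$ along $\mathcal{R}$. The contact Hamiltonian vector field $X_H$ is the unique vector field with $$\iota_{X_H}\eta_{\mathcal{Q}}=-H,\qquad \iota_{X_H}d\eta_{\mathcal{Q}}=dH-\mathcal{R}(H)\,\eta_{\mathcal{Q}},$$ i.e. in coordinates $X_H=\frac{\partial H}{\partial p_i}\frac{\partial}{\partial q^i}-\big(\frac{\partial H}{\partial q^i}+p_i\frac{\partial H}{\partial z}\big)\frac{\partial}{\partial p_i}+\big(p_i\frac{\partial H}{\partial p_i}-H\big)\frac{\partial}{\partial z}$. The fibration $\rho$ is $\rho:T^*\mathcal{Q}\times\mathbb{R}\to\mathcal{Q}\times\mathbb{R}$, $\rho(w,z)=(\pi_{\mathcal{Q}}(w),z)$, with $\pi_{\mathcal{Q}}:T^*\mathcal{Q}\to\mathcal{Q}$ the cotangent projection. *)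

(* Defs.v *)
From HB Require Import structures.
From mathcomp Require Import all_boot all_order all_algebra.
From mathcomp Require Import all_classical all_reals all_analysis.

Set Implicit Arguments.
Unset Strict Implicit.
Unset Printing Implicit Defensive.

Import Order.TTheory GRing.Theory Num.Theory.
Import numFieldNormedType.Exports.

Local Open Scope classical_set_scope.
Local Open Scope ring_scope.

(* f is C^(k+1) on the open set U iff it is differentiable on U and its tangent
   map (x, v) |-> Df(x)v is C^k on U * E.  For finite-dimensional E (the only
   case used) this is the usual class C^k; U is open in all uses. *)
Fixpoint Ck (R : realType) (k : nat) (E F : normedModType R) (U : set E)
    (f : E -> F) : Prop :=
  if k is k'.+1 then
    (forall x, U x -> differentiable f x) /\
    Ck k' (U `*` setT) (fun y : E * E => 'd f (y.1) (y.2))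
  else forall x, U x -> {for x, continuous f}.

Definition smooth_on (R : realType) (E F : normedModType R) (U : set E)
    (f : E -> F) : Prop := forall k, Ck k U f.

Section SmoothTheory.
Context {R : realType}.
Implicit Types (E F G : normedModType R).

Lemma near_diff E F (f g : E -> F) (x : E) :
  (\near x, f x = g x) -> differentiable f x ->
  differentiable g x /\ 'd g x = 'd f x :> (E -> F).
Proof.
move=> fg df; pose e := g - f.
have e0 : is_diff x e (fun=> 0).
  have ee : e \o shift x = cst (e x) + (\0 : {linear E -> F}) +o_ 0 id.
    apply/eqaddoP => _/posnumP[eps]; have fgx := nbhs_singleton fg.
    have ey y : e y = g y - f y by [].
    rewrite (near_shift 0 x) in fg.
    have ex : e x = 0 by rewrite ey fgx subrr.
    near=> h; suff -> : ((e \o shift x) - (cst (e x) + \0)) h = 0.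
      by rewrite normr0 mulr_ge0.
    have fgh : f (h + x) = g (h + x).
      by near: h; apply: filterS fg => h /=; rewrite subr0.
    rewrite -[LHS]/(e (h + x) - (e x + 0)).
    by rewrite ex ey fgh subrr addr0 subr0.
  have c0 : continuous (\0 : {linear E -> F}) by move=> y; exact: cvg_cst.
  have d0 := diff_unique c0 ee.
  split => //; apply/diff_locallyP; rewrite d0; split=> //.
have gE : f + e = g by rewrite /e addrC subrK.
have [de eE] := e0.
have dD : 'd (f + e) x = ('d f x : E -> F) + 'd e x :> (E -> F) := diffD df de.
have dfe : differentiable (f + e) x := differentiableD df de.
rewrite gE in dD dfe; split; first exact: dfe.
by apply: (etrans dD); rewrite eE; apply/funext => v; exact: addr0.
Unshelve. all: by end_near. Qed.

Lemma Ck_sub k E F (U V : set E) (f : E -> F) :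
  V `<=` U -> Ck k U f -> Ck k V f.
Proof.
elim: k E F U V f => [|k IH] E F U V f VU /=; first by move=> h x /VU /h.
move=> [df cf]; split; first by move=> x /VU /df.
by apply: IH cf => -[x v] [] /= /VU.
Qed.

Lemma open_setXT E G (U : set E) : open U -> open (U `*` [set: G]).
Proof.
move=> oU; have -> : U `*` [set: G] = fst @^-1` U.
  by apply/seteqP; split=> -[x y] //= [].
by apply: open_comp => // -[x y] _; exact: cvg_fst.
Qed.

Lemma Ck_eq k E F (U : set E) (f g : E -> F) :
  open U -> (forall x, U x -> f x = g x) -> Ck k U f -> Ck k U g.
Proof.
elim: k E F U f g => [|k IH] E F U f g oU fg /=.
  move=> cf x Ux; have fgx : \near x, f x = g x.
    by apply: filterS (open_nbhs_nbhs (conj oU Ux)) => y /fg.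
  rewrite /prop_for /continuous_at -(fg _ Ux); apply: cvg_trans (cf _ Ux).
  exact: near_eq_cvg.
have nd x : U x -> differentiable f x ->
    differentiable g x /\ 'd g x = 'd f x :> (E -> F).
  move=> Ux; apply: near_diff.
  by apply: filterS (open_nbhs_nbhs (conj oU Ux)) => y /fg.
move=> [df cf]; split; first by move=> x Ux; have [] := nd _ Ux (df _ Ux).
apply: IH cf; first exact: open_setXT.
move=> [x v] [Ux _]; have [_ dE] := nd _ Ux (df _ Ux).
exact: esym (congr1 (@^~ v) dE).
Qed.

Lemma CkS k E F (U : set E) (f : E -> F) : Ck k.+1 U f -> Ck k U f.
Proof.
elim: k E F U f => [|k IH] E F U f [df cf].
  by move=> x /df; exact: differentiable_continuous.
by split=> //; exact: IH.
Qed.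

Lemma Ck_lin k E F (U : set E) (f : {linear E -> F}) :
  continuous f -> Ck k U f.
Proof.
have dl E' (g : {linear E' -> F}) : continuous g ->
    forall j (V : set E'), Ck j V g.
  move=> cg j; elim: j E' g cg => [|j IH] E' g cg V; first by move=> x _; exact: cg.
  split=> [x _|]; first exact: linear_differentiable.
  have -> : (fun y : E' * E' => 'd g (y.1) (y.2)) =
      ((g \o snd) : {linear (E' * E')%type -> F}).
    by apply/funext => y; rewrite (diff_lin _ cg).
  by apply: IH => y; apply: continuous_comp; [exact: cvg_snd|exact: cg].
by move=> cf; exact: dl.
Qed.

Lemma Ck_fst k E F (U : set (E * F)) : Ck k U fst.
Proof. by apply: Ck_lin => x; exact: cvg_fst. Qed.

Lemma Ck_snd k E F (U : set (E * F)) : Ck k U snd.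
Proof. by apply: Ck_lin => x; exact: cvg_snd. Qed.

Lemma Ck_cst k E F (U : set E) (c : F) : Ck k U (fun=> c).
Proof.
case: k => [|k] /=; first by move=> x _; exact: cvg_cst.
split; first by move=> x _; exact: differentiable_cst.
have -> : (fun y : E * E => 'd (cst c : E -> F) (y.1) (y.2)) = (fun=> 0).
  by apply/funext => y; rewrite diff_cst.
by apply: (@Ck_lin _ _ _ _ \0) => y; exact: cvg_cst.
Qed.

Lemma Ck_pair k E F G (U : set E) (f : E -> F) (g : E -> G) :
  open U -> Ck k U f -> Ck k U g -> Ck k U (fun x => (f x, g x)).
Proof.
elim: k E F G U f g => [|k IH] E F G U f g oU /=.
  by move=> cf cg x Ux; apply: cvg_pair; [exact: cf|exact: cg].
move=> [df cf] [dg cg]; split.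
  by move=> x Ux; apply: differentiable_pair; [exact: df|exact: dg].
apply: (@Ck_eq _ _ _ _ (fun y : E * E => ('d f (y.1) (y.2), 'd g (y.1) (y.2)))).
- exact: open_setXT.
- move=> [x v] [] /= Ux _.
  by rewrite diff_pair //; [exact: df|exact: dg].
- by apply: IH => //; exact: open_setXT.
Qed.

Lemma Ck_comp k E F G (U : set E) (V : set F) (f : E -> F) (g : F -> G) :
  open U -> (forall x, U x -> V (f x)) ->
  Ck k U f -> Ck k V g -> Ck k U (g \o f).
Proof.
elim: k E F G U V f g => [|k IH] E F G U V f g oU UV.
  by move=> cf cg x Ux; apply: continuous_comp; [exact: cf|exact/cg/UV].
move=> cf cg; have [df cdf] := cf; have [dg cdg] := cg.
split.
  by move=> x Ux; apply: differentiable_comp; [exact: df|exact/dg/UV].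
pose fg (y : E * E) := (f y.1, 'd f (y.1) (y.2)).
apply: (@Ck_eq _ _ _ _ ((fun z : F * F => 'd g (z.1) (z.2)) \o fg)).
- exact: open_setXT.
- move=> [x v] [] /= Ux _.
  by rewrite (diff_comp (df _ Ux) (dg _ (UV _ Ux))).
- apply: (IH _ _ _ _ (V `*` setT)) => //; first exact: open_setXT.
    by move=> [x v] [] /= Ux _; split => //; exact: UV.
  apply: Ck_pair => //; first exact: open_setXT.
  apply: (IH _ _ _ _ U fst f) => //; first exact: open_setXT.
  + by move=> x [].
  + exact: Ck_fst.
  + exact: CkS.
Qed.

Lemma Ck_add k E F (U : set E) (f g : E -> F) :
  open U -> Ck k U f -> Ck k U g -> Ck k U (fun x => f x + g x).
Proof.
move=> oU cf cg.
apply: (@Ck_comp _ _ _ _ _ setT (fun x => (f x, g x)) (fun z => z.1 + z.2)) => //.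
  exact: Ck_pair.
by apply: (@Ck_lin _ _ _ _ (fst \+ snd)) => x; exact: add_continuous.
Qed.

Lemma Ck_sum k E F n (U : set E) (f : 'I_n -> E -> F) :
  open U -> (forall j, Ck k U (f j)) -> Ck k U (fun x => \sum_j f j x).
Proof.
move=> oU; elim: n f => [|n IH] f cf.
  by under eq_fun do rewrite big_ord0; exact: Ck_cst.
under eq_fun do rewrite big_ord_recl.
by apply: Ck_add => //; exact: IH.
Qed.

Lemma Ck_mulr k (U : set (R * R)) : Ck k U (fun z : R * R => z.1 * z.2).
Proof.
elim: k U => [|k IH] U.
  by move=> x _; apply: differentiable_continuous; exact: ex_diff.
split=> [x _|]; first exact: ex_diff.
have -> : (fun y : (R * R) * (R * R) => 'd (fun z : R * R => z.1 * z.2) (y.1) (y.2))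
   = (fun y => y.1.1 * y.2.2 + y.1.2 * y.2.1).
  by apply/funext => y; rewrite diff_val /= [X in _ + X]mulrC.
apply: (@Ck_sub _ _ _ setT) => //.
have oT : open [set: (R * R) * (R * R)] by exact: openT.
have c2 (f g : (R * R) * (R * R) -> R) :
    Ck k setT f -> Ck k setT g -> Ck k setT (fun y => f y * g y).
  move=> lf lg.
  apply: (@Ck_comp _ _ _ _ _ setT (fun x => (f x, g x)) (fun z => z.1 * z.2)) => //.
  exact: Ck_pair.
by apply: Ck_add => //; apply: c2; apply: (@Ck_comp _ _ _ _ _ setT) => //;
  [exact: Ck_fst|exact: Ck_fst|exact: Ck_snd|exact: Ck_snd|
   exact: Ck_fst|exact: Ck_snd|exact: Ck_snd|exact: Ck_fst].
Qed.

Lemma Ck_mul k E (U : set E) (f g : E -> R) :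
  open U -> Ck k U f -> Ck k U g -> Ck k U (fun x => f x * g x).
Proof.
move=> oU cf cg.
apply: (@Ck_comp _ _ _ _ _ setT (fun x => (f x, g x)) (fun z => z.1 * z.2)) => //.
  exact: Ck_pair.
exact: Ck_mulr.
Qed.

Lemma Ck_coord k E n (U : set E) (f : E -> 'rV[R]_n) (j : 'I_n) :
  open U -> Ck k U f -> Ck k U (fun x => f x 0 j).
Proof.
move=> oU cf; apply: (@Ck_comp _ _ _ _ _ setT f (fun v => v 0 j)) => //.
have @c : {linear 'rV[R]_n -> R}.
  by exists (fun N : 'rV[R]_n => N 0 j); do 2![eexists]; do ?[constructor];
     rewrite ?mxE// => ? *; rewrite ?mxE//; move=> ?; rewrite !mxE.
by apply: (@Ck_lin _ _ _ _ c); exact: coord_continuous.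
Qed.

Lemma Ck_row k E n (U : set E) (f : E -> 'rV[R]_n) :
  open U -> (forall j, Ck k U (fun x => f x 0 j)) -> Ck k U f.
Proof.
move=> oU cf.
have -> : f = (fun x => \sum_j f x 0 j *: delta_mx 0 j).
  by apply/funext => x; exact: row_sum_delta.
apply: Ck_sum => // j.
apply: (@Ck_comp _ _ _ _ _ setT (fun x => f x 0 j) (fun a => a *: delta_mx 0 j)) => //.
have sx_lin : linear (fun a : R => a *: delta_mx 0 j : 'rV[R]_n).
  by move=> u y z; rewrite scalerDl scalerA.
pose sxlM := GRing.isLinear.Build _ _ _ _ _ sx_lin.
pose sxL : {linear R -> 'rV[R]_n} := HB.pack (fun a : R => a *: delta_mx 0 j) sxlM.
by apply: (@Ck_lin _ _ _ _ sxL); exact: scalel_continuous.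
Qed.

End SmoothTheory.

(* The open sets of the topology defined by the charts. *)
Definition chart_open (E : topologicalType) (M I : Type) (dom : I -> set M)
    (chart_map : I -> M -> E) (U : set M) : Prop :=
  forall i, open (chart_map i @` (dom i `&` U)).

(* A manifold as a set with a smooth atlas: the topology is the one generated
   by the charts, required to be Hausdorff and second countable (for a
   finite-dimensional E: countably many charts cover).  chart_map i is a chart
   with domain dom i, and chart_inv i its inverse; outside their domains both
   are arbitrary.  chart_at selects a chart around each point; it only serves to
   write down tangent vectors. *)
Record manifold (R : realType) (E : normedModType R) := Manifold {
  pt :> Type;
  chart : Type;
  dom : chart -> set pt;
  chart_map : chart -> pt -> E;
  chart_inv : chart -> E -> pt;
  chart_at : pt -> chart;
  mem_chart_at : forall x, dom (chart_at x) x;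
  chart_mapK : forall i x, dom i x -> chart_inv i (chart_map i x) = x;
  open_overlap : forall i j, open (chart_map i @` (dom i `&` dom j));
  smooth_transition : forall i j,
    smooth_on (chart_map i @` (dom i `&` dom j)) (chart_map j \o chart_inv i);
  hausdorff_manifold : forall x y, x <> y -> exists U V : set pt,
    [/\ chart_open dom chart_map U, chart_open dom chart_map V, U x, V y &
        U `&` V = set0];
  countable_charts : exists2 J : set chart,
    countable J & forall x, exists2 i, J i & dom i x }.

Arguments chart_at {R E m} x.

Lemma chart_open_preimage (R : realType) (E : normedModType R) (M I : Type)
    (dom : I -> set M) (chart_map : I -> M -> E) (chart_inv : I -> E -> M) :
  (forall i x, dom i x -> chart_inv i (chart_map i x) = x) ->
  (forall i j, open (chart_map i @` (dom i `&` dom j))) ->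
  (forall i j,
    smooth_on (chart_map i @` (dom i `&` dom j)) (chart_map j \o chart_inv i)) ->
  forall i B, open B ->
    chart_open dom chart_map (dom i `&` chart_map i @^-1` B).
Proof.
move=> cK oO sT i B oB j.
set U := chart_map j @` (dom j `&` dom i).
have -> : chart_map j @` (dom j `&` (dom i `&` chart_map i @^-1` B)) =
    U `&` (chart_map i \o chart_inv j) @^-1` B.
  apply/seteqP; split=> [_ [x [jx [ix Bx]] <-]|_ [[x [jx ix] <-]] /=].
    by split; [exists x|rewrite /= cK].
  by rewrite cK // => Bx; exists x.
rewrite openE => y [Uy By]; apply: filterI.
  by apply: open_nbhs_nbhs; split => //; exact: oO.
by apply: (sT j i 0%N y Uy); exact: open_nbhs_nbhs.
Qed.

(* M x R with the product charts. *)
Section ProdLine.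
Context {R : realType} {E : normedModType R} (M : manifold E).

Let pdom (i : chart M) : set (M * R) := dom i `*` setT.
Let pcoord (i : chart M) (x : M * R) : E * R := (chart_map i x.1, x.2).
Let pparam (i : chart M) (y : E * R) : M * R := (chart_inv i y.1, y.2).

Let image_pcoord i (A : set M) :
  pcoord i @` (dom i `*` setT `&` A `*` setT) =
  (chart_map i @` (dom i `&` A)) `*` setT.
Proof.
apply/seteqP; split=> [_ [[x z] /= [[ix _] [Ax _]] <-]|[y z] [] /= [x [ix Ax] <-] _].
  by split=> //; exists x.
by exists (x, z).
Qed.

Fact prod_line_mem x : pdom (chart_at x.1) x.
Proof. by split=> //; exact: mem_chart_at. Qed.

Fact prod_lineK i x : pdom i x -> pparam i (pcoord i x) = x.
Proof. by case: x => x z [] /= ix _; rewrite /pparam chart_mapK. Qed.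

Fact prod_line_open i j : open (pcoord i @` (pdom i `&` pdom j)).
Proof. by rewrite image_pcoord; apply: open_setXT; exact: open_overlap. Qed.

Fact prod_line_smooth i j :
  smooth_on (pcoord i @` (pdom i `&` pdom j)) (pcoord j \o pparam i).
Proof.
move=> k; rewrite image_pcoord; have oU := @open_overlap _ _ M i j.
apply: Ck_pair; [exact: open_setXT| |exact: Ck_snd].
apply: (@Ck_comp _ _ _ _ _ _ (chart_map i @` (dom i `&` dom j)) fst
  (chart_map j \o chart_inv i)).
- exact: open_setXT.
- by move=> x [].
- exact: Ck_fst.
- exact: smooth_transition.
Qed.

Fact prod_line_hausdorff x y : x <> y -> exists U V : set (M * R),
  [/\ chart_open pdom pcoord U, chart_open pdom pcoord V, U x, V y &
      U `&` V = set0].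
Proof.
move: x y => [x z] [x' z'] neq.
have [xx'|/hausdorff_manifold[U [V [oU oV Ux Vx' UV]]]] := pselect (x = x').
  subst x'; have /eqP zz' : z != z' by apply/eqP => zz'; apply: neq; rewrite zz'.
  have := @norm_hausdorff _ R; rewrite open_hausdorff => /(_ z z').
  case; first exact/eqP.
  move=> [A B] /= [/set_mem Az /set_mem Bz'] [oA oB /eqP AB].
  have cp (C : set R) (oC : open C) : chart_open pdom pcoord (setT `*` C).
    move=> i; have -> : pcoord i @` (pdom i `&` setT `*` C) =
        (chart_map i @` (dom i `&` dom i)) `*` C.
      apply/seteqP; split=> [_ [[w t] /= [[iw _] [_ Ct]] <-]|[u t] [] /= [w [iw _] <-] Ct].
        by split=> //; exists w.
      by exists (w, t).
    have -> : (chart_map i @` (dom i `&` dom i)) `*` C =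
        ((chart_map i @` (dom i `&` dom i)) `*` setT) `&` (snd @^-1` C).
      by apply/seteqP; split=> -[u t] /=; [move=> [? ?]|move=> [[? _] ?]].
    apply: openI; first by apply: open_setXT; exact: open_overlap.
    by apply: open_comp => // -[u t] _; exact: cvg_snd.
  exists (setT `*` A), (setT `*` B); split=> //; try exact: cp.
  apply/seteqP; split=> // -[w t] /= [[_ At] [_ Bt]].
  by have : (A `&` B) t by []; rewrite AB.
exists (U `*` setT), (V `*` setT); split=> //.
- by move=> i; rewrite image_pcoord; exact: open_setXT.
- by move=> i; rewrite image_pcoord; exact: open_setXT.
- apply/seteqP; split=> // -[w t] /= [[Uw _] [Vw _]].
  by have : (U `&` V) w by []; rewrite UV.
Qed.

Fact prod_line_countable : exists2 J : set (chart M),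
  countable J & forall x, exists2 i, J i & pdom i x.
Proof.
have [J cJ Jc] := countable_charts M; exists J => // -[x z].
by have [i Ji ix] := Jc x; exists i.
Qed.

Definition prod_line : manifold (E * R)%type :=
  {| pt := M * R; chart := chart M;
     dom := pdom; chart_map := pcoord; chart_inv := pparam;
     chart_at := fun x => chart_at x.1;
     mem_chart_at := prod_line_mem; chart_mapK := prod_lineK;
     open_overlap := prod_line_open; smooth_transition := prod_line_smooth;
     hausdorff_manifold := prod_line_hausdorff;
     countable_charts := prod_line_countable |}.

End ProdLine.

Section Calculus.
Context {R : realType}.

(* T_x M is represented by the model space E: v stands for the tangent vector
   with components v in the preferred chart at x, and its components in a
   chart i around x are 'd (chart_map i \o chart_inv (chart_at x)) (...) v. *)
Definition tangent (E : normedModType R) (M : manifold E) (x : M) :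
  normedModType R := E.

(* Smoothness is not part of the next two types: the Reeb and contact
   Hamiltonian fields are determined pointwise by their equations, hence
   automatically smooth. *)
Definition vector_field (E : normedModType R) (M : manifold E) :=
  forall x : M, tangent x.

Definition covector_field (E : normedModType R) (M : manifold E) :=
  forall x : M, tangent x -> R.

Definition smooth_fun (E : normedModType R) (M : manifold E) (h : M -> R) :=
  forall i : chart M, smooth_on (chart_map i @` dom i) (h \o chart_inv i).

Definition smooth_map (E F : normedModType R) (M : manifold E)
    (N : manifold F) (f : M -> N) : Prop :=
  forall (i : chart M) (j : chart N),
    let U := chart_map i @` (dom i `&` f @^-1` dom j) in
    open U /\ smooth_on U (chart_map j \o f \o chart_inv i).

Definition tangent_map (E F : normedModType R) (M : manifold E)
    (N : manifold F) (f : M -> N) (x : M) (v : tangent x) : tangent (f x) :=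
  'd (chart_map (chart_at (f x)) \o f \o chart_inv (chart_at x))
     (chart_map (chart_at x) x) v.

Definition related (E F : normedModType R) (M : manifold E) (N : manifold F)
    (f : M -> N) (X : vector_field M) (Y : vector_field N) : Prop :=
  forall x, tangent_map f (X x) = Y (f x).

Definition differential (E : normedModType R) (M : manifold E) (h : M -> R) :
    covector_field M :=
  fun x v => 'd (h \o chart_inv (chart_at x)) (chart_map (chart_at x) x) v.

Definition pullback (E F : normedModType R) (M : manifold E)
    (N : manifold F) (f : M -> N) (a : covector_field N) : covector_field M :=
  fun x v => a (f x) (tangent_map f v).

(* The local representative of a in the chart i: at y it maps the vector with
   components v in the chart i to its value under a. *)
Definition in_chart (E : normedModType R) (M : manifold E)
    (a : covector_field M) (i : chart M) (y v : E) : R :=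
  a (chart_inv i y)
    ('d (chart_map (chart_at (chart_inv i y)) \o chart_inv i) y v).

(* da = sum_(k,l) (d a_l / d y_k) dy_k /\ dy_l in the chart at x, with
   (s /\ t)(u, v) = s(u) t(v) - s(v) t(u); for a smooth one-form every chart
   gives the same value, by symmetry of second derivatives. *)
Definition ext_diff (E : normedModType R) (M : manifold E)
    (a : covector_field M) (x : M) (u v : tangent x) : R :=
  let i := chart_at x in
  'd (fun y => in_chart a i y v) (chart_map i x) u -
  'd (fun y => in_chart a i y u) (chart_map i x) v.

End Calculus.

Lemma mulmx_jacobian (R : realType) m n (f : 'rV[R]_m -> 'rV[R]_n) x v :
  v *m 'J f x = 'd f x v.
Proof. exact: mul_rV_lin1. Qed.

(* T*Q.  The pair (q, p) is the covector at q with components p in the dual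
   basis of the preferred chart at q.  In a chart i around q its components are
   p composed with the differential at chart_map i q of the change of
   coordinates from i to chart_at q ('J acts on row vectors on the right, hence
   the transpose). *)
Section Cotangent.
Context {R : realType} {n : nat} (Q : manifold 'rV[R]_n).

Let E : normedModType R := 'rV[R]_n.

Definition transition (i j : chart Q) : E -> E := chart_map j \o chart_inv i.

Lemma transition_diff i j q : dom i q -> dom j q ->
  differentiable (transition i j) (chart_map i q).
Proof.
move=> iq jq; have [+ _] := smooth_transition i j 1%N.
by apply; exists q.
Qed.

Lemma jacobian_transition_id i q : dom i q -> 'J (transition i i) (chart_map i q) = 1%:M.
Proof.
move=> iq.
have [] := @near_diff _ _ _ id (transition i i) (chart_map i q) _
  (@ex_diff _ _ _ _ _ _ _ (is_diff_id (chart_map i q))).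
  have : nbhs (chart_map i q) (chart_map i @` (dom i `&` dom i)).
    by apply: open_nbhs_nbhs; split; [exact: open_overlap|exists q].
  by apply: filterS => _ [x [ix _] <-]; rewrite /transition /= chart_mapK.
move=> _ d; apply/row_matrixP => k.
rewrite [LHS]rowE [RHS]rowE mulmx_jacobian d diff_val.
by rewrite mulmx1.
Qed.

Lemma jacobian_transition i j k q : dom i q -> dom j q -> dom k q ->
  'J (transition i j) (chart_map i q) *m 'J (transition j k) (chart_map j q) =
  'J (transition i k) (chart_map i q).
Proof.
move=> iq jq kq.
have tq : transition i j (chart_map i q) = chart_map j q by rewrite /transition /= chart_mapK.
have dij := transition_diff iq jq.
have djk : differentiable (transition j k) (transition i j (chart_map i q)).
  by rewrite tq; exact: transition_diff.
have [] := @near_diff _ _ _ (transition j k \o transition i j) (transition i k)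
  (chart_map i q) _ (differentiable_comp dij djk).
  have : nbhs (chart_map i q) (chart_map i @` (dom i `&` dom j)).
    by apply: open_nbhs_nbhs; split; [exact: open_overlap|exists q].
  by apply: filterS => _ [x [ix jx] <-]; rewrite /transition /= !chart_mapK.
move=> _ d; have dE := diff_comp dij djk.
apply/row_matrixP => l; rewrite [LHS]rowE [RHS]rowE mulmxA.
rewrite [X in X *m _ = _]mulmx_jacobian [LHS]mulmx_jacobian [RHS]mulmx_jacobian.
by rewrite -[in LHS]tq; apply/esym; exact: (congr1 (@^~ (delta_mx 0 l)) (etrans d dE)).
Qed.

Let cdom (i : chart Q) : set (Q * E) := dom i `*` setT.
Let ccoord (i : chart Q) (w : Q * E) : E * E :=
  (chart_map i w.1, w.2 *m ('J (transition i (chart_at w.1)) (chart_map i w.1))^T).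
Let cparam (i : chart Q) (y : E * E) : Q * E :=
  let q := chart_inv i y.1 in
  (q, y.2 *m ('J (transition (chart_at q) i) (chart_map (chart_at q) q))^T).

Let ctrans i j q p : dom i q -> dom j q ->
  ccoord j (cparam i (chart_map i q, p)) =
  (chart_map j q, p *m ('J (transition j i) (chart_map j q))^T).
Proof.
move=> iq jq; rewrite /ccoord /cparam; cbn [fst snd]; rewrite !(chart_mapK iq).
apply: (congr1 (pair _)).
rewrite -mulmxA.
rewrite -trmx_mul.
by rewrite (jacobian_transition jq (mem_chart_at q) iq).
Qed.

Fact cotangent_mem w : cdom (chart_at w.1) w.
Proof. by split=> //; exact: mem_chart_at. Qed.

Fact cotangentK i w : cdom i w -> cparam i (ccoord i w) = w.
Proof.
case: w => q p [iq _]; rewrite /cparam /ccoord; cbn [fst snd].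
rewrite !(chart_mapK iq); apply: (congr1 (pair _)).
rewrite -mulmxA.
rewrite -trmx_mul.
have cq := mem_chart_at q.
by rewrite (jacobian_transition cq iq cq) (jacobian_transition_id cq) trmx1 [LHS]mulmx1.
Qed.

Let image_ccoord i (A : set Q) :
  ccoord i @` (cdom i `&` A `*` setT) = (chart_map i @` (dom i `&` A)) `*` setT.
Proof.
apply/seteqP; split=> [_ [[q p] [[iq _] [Aq _]] <-]|[y r]].
  by split; [exists q|].
rewrite /setX /mkset; cbn [fst snd] => -[[q [iq Aq] <-] _].
exists (cparam i (chart_map i q, r)).
  by rewrite /cparam; cbn [fst snd]; rewrite (chart_mapK iq).
by rewrite (ctrans _ iq iq) (jacobian_transition_id iq) trmx1 mulmx1.
Qed.

Fact cotangent_open i j : open (ccoord i @` (cdom i `&` cdom j)).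
Proof. by rewrite image_ccoord; apply: open_setXT; exact: open_overlap. Qed.

Fact cotangent_smooth i j :
  smooth_on (ccoord i @` (cdom i `&` cdom j)) (ccoord j \o cparam i).
Proof.
move=> k; rewrite image_ccoord.
set U := chart_map i @` _; set V := chart_map j @` (dom j `&` dom i).
have oU : open U by exact: open_overlap.
have oUT := open_setXT (G := E) oU.
have UV y : U y -> V (transition i j y).
  by move=> [x [ix jx] <-]; exists x => //; rewrite /transition /= chart_mapK.
pose p' (y : E * E) := \row_l \sum_m y.2 0 m *
  ('d (transition j i) (transition i j y.1) (delta_mx 0 l)) 0 m.
apply: (@Ck_eq _ _ _ _ _ (fun y : E * E => (transition i j y.1, p' y))) => //.
  move=> [y p]; rewrite /setX /mkset; cbn [fst snd] => -[[x [ix jx] <-] _].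
  have tx : transition i j (chart_map i x) = chart_map j x by rewrite /transition /= chart_mapK.
  rewrite [RHS](ctrans _ ix jx) /p'; cbn [fst snd]; rewrite tx; apply: (congr1 (pair _)).
  apply/rowP => l; rewrite [LHS]mxE [RHS]mxE.
  apply: eq_bigr => m _; rewrite [X in _ = _ * X]mxE; congr (_ * _).
  by rewrite [RHS]mxE.
have c1 l : Ck l (U `*` setT) (fun y : E * E => transition i j y.1).
  apply: (@Ck_comp _ _ _ _ _ _ U fst (transition i j)) => //; first by move=> y [].
    exact: Ck_fst.
  exact: smooth_transition.
apply: Ck_pair => //; first exact: c1.
apply: Ck_row => // l.
apply: (@Ck_eq _ _ _ _ _ (fun y : E * E =>
  \sum_m y.2 0 m * ('d (transition j i) (transition i j y.1) (delta_mx 0 l)) 0 m)) => //.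
  by move=> y _; rewrite [RHS]mxE.
apply: Ck_sum => // m; apply: Ck_mul => //.
  by apply: Ck_coord => //; exact: Ck_snd.
apply: Ck_coord => //.
pose h (y : E * E) : E * E := (transition i j y.1, delta_mx 0 l).
apply: (@Ck_comp _ _ _ _ _ _ (V `*` setT) h
  (fun z : E * E => 'd (transition j i) (z.1) (z.2))) => //.
- by move=> y [Uy _]; split=> //; exact: UV.
- by apply: Ck_pair => //; [exact: c1|exact: Ck_cst].
- by have [] := smooth_transition j i k.+1.
Qed.

Fact cotangent_hausdorff w w' : w <> w' -> exists U V : set (Q * E),
  [/\ chart_open cdom ccoord U, chart_open cdom ccoord V, U w, V w' &
      U `&` V = set0].
Proof.
move: w w' => [q p] [q' p'] neq.
have [qq'|/hausdorff_manifold[U [V [oU oV Uq Vq' UV]]]] := pselect (q = q').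
  subst q'; pose i := chart_at q.
  have iq : dom i q := mem_chart_at q.
  have cneq : ccoord i (q, p) != ccoord i (q, p').
    apply/eqP => e; apply: neq.
    by rewrite -(@cotangentK i (q, p) (conj iq I)) e (@cotangentK i (q, p') (conj iq I)).
  have := @norm_hausdorff _ (E * E)%type; rewrite open_hausdorff => /(_ _ _ cneq).
  move=> [[A B]] /= [/set_mem Ap /set_mem Bp'] [oA oB /eqP AB].
  have cp := chart_open_preimage cotangentK cotangent_open cotangent_smooth i.
  exists (cdom i `&` ccoord i @^-1` A), (cdom i `&` ccoord i @^-1` B).
  split=> //; try exact: cp.
  apply/seteqP; split=> // x /= [[_ Ax] [_ Bx]].
  by have : (A `&` B) (ccoord i x) by []; rewrite AB.
exists (U `*` setT), (V `*` setT); split=> //.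
- by move=> i; rewrite image_ccoord; apply: open_setXT; exact: oU.
- by move=> i; rewrite image_ccoord; apply: open_setXT; exact: oV.
- apply/seteqP; split=> // -[x t] /= [[Ux _] [Vx _]].
  by have : (U `&` V) x by []; rewrite UV.
Qed.

Fact cotangent_countable : exists2 J : set (chart Q),
  countable J & forall w, exists2 i, J i & cdom i w.
Proof.
have [J cJ Jc] := countable_charts Q; exists J => // -[q p].
by have [i Ji iq] := Jc q; exists i.
Qed.

Definition cotangent : manifold (E * E)%type :=
  {| pt := Q * E; chart := chart Q;
     dom := cdom; chart_map := ccoord; chart_inv := cparam;
     chart_at := fun w => chart_at w.1;
     mem_chart_at := cotangent_mem; chart_mapK := cotangentK;
     open_overlap := cotangent_open; smooth_transition := cotangent_smooth;
     hausdorff_manifold := cotangent_hausdorff;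
     countable_charts := cotangent_countable |}.

End Cotangent.

Section ContactBundle.
Context {R : realType} {n : nat} (Q : manifold 'rV[R]_n).

Definition cotangent_proj : cotangent Q -> Q := fst.

Definition pairing (p v : 'rV[R]_n) : R := \sum_k p 0 k * v 0 k.

(* a q is the covector at q with components a q in the dual basis of the
   preferred chart at q. *)
Definition one_form := Q -> 'rV[R]_n.

Definition one_form_section (a : one_form) : Q -> cotangent Q :=
  fun q => (q, a q).

Definition smooth_one_form (a : one_form) : Prop :=
  smooth_map (one_form_section a).

Definition closed_one_form (a : one_form) : Prop :=
  forall q (u v : tangent q),
    ext_diff (fun q' w => pairing (a q') w : R) u v = 0.

Definition canonical_one_form : covector_field (cotangent Q) :=
  fun w u => pairing w.2 (tangent_map cotangent_proj u).

Definition ext_cotangent := prod_line (cotangent Q).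

Definition fibration : ext_cotangent -> prod_line Q :=
  fun x => (cotangent_proj x.1, x.2).

Definition contact_form : covector_field ext_cotangent :=
  fun x u => differential (M := ext_cotangent) snd u -
    pullback (M := ext_cotangent) (N := cotangent Q) fst canonical_one_form u.

Definition is_reeb_field (Z : vector_field ext_cotangent) : Prop :=
  forall x, contact_form (Z x) = 1 /\
    forall u : tangent x, ext_diff contact_form (Z x) u = 0.

Definition is_contact_hamiltonian_field (Z : vector_field ext_cotangent)
    (H : ext_cotangent -> R) (X : vector_field ext_cotangent) : Prop :=
  forall x, contact_form (X x) = - H x /\
    forall u : tangent x, ext_diff contact_form (X x) u =
      differential H u - differential H (Z x) * contact_form u.

Definition lift_section (a : one_form) : prod_line Q -> ext_cotangent :=
  fun b => (one_form_section a b.1, b.2).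

Definition projected_field (X : vector_field ext_cotangent) (a : one_form) :
    vector_field (prod_line Q) :=
  fun b => tangent_map fibration (X (lift_section a b)).

End ContactBundle.

(* Main.v *)
(* In the coordinates (q, p, z) of the preferred chart at a base point,
   deta(X, W) = <W_p, X_q> - <X_p, W_q> and Tgamma(v, s) = (v, Dv, s), where D is
   the derivative of the components of gamma_hat, a symmetric matrix because
   gamma_hat is closed.  Applying X_H's equation to vectors Tgamma(v, s), the
   chain rule d(H o gamma) = dH o Tgamma turns condition 2 into
   deta(X_H, Tgamma(v, s)) = 0, that is <Dv, X_q> = <X_p, v> for every v.  By the
   symmetry of D this says D X_q = X_p, which is condition 1, since
   Tgamma (Trho X) = (X_q, D X_q, X_z). *)
From HB Require Import structures.
Require Import Defs.
From mathcomp Require Import all_boot all_order all_algebra.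
From mathcomp Require Import all_classical all_reals all_analysis.

Set Implicit Arguments.
Unset Strict Implicit.
Unset Printing Implicit Defensive.

Import GRing.Theory.
Import numFieldNormedType.Exports.

Local Open Scope classical_set_scope.
Local Open Scope ring_scope.

(** * Differentials of maps between normed spaces *)

Section Differentials.
Context {R : realType}.
Implicit Types (E F G : normedModType R).

Lemma diff_near_eq E F (f g : E -> F) (x v : E) :
  (\near x, f x = g x) -> differentiable f x -> 'd g x v = 'd f x v.
Proof. by move=> fg /(near_diff fg)[_ ->]. Qed.

Lemma diff_lin_comp E F G (f : E -> F) (g : {linear F -> G}) (x v : E) :
  continuous g -> differentiable f x -> 'd (g \o f) x v = g ('d f x v).
Proof.
move=> cg df; have dg : differentiable g (f x) by exact: linear_differentiable.
by rewrite (diff_comp df dg) /=; rewrite (diff_lin _ cg).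
Qed.

(* The projections p, p' of a chart expression T onto its q, (q, p) or z part
   give the components of its differential. *)
Lemma diff_semiconj E E' F F' (T : E -> E') (f : F -> F')
    (p : {linear E -> F}) (p' : {linear E' -> F'}) (x v : E) :
  continuous p -> continuous p' -> p' \o T = f \o p ->
  differentiable T x -> differentiable f (p x) ->
  p' ('d T x v) = 'd f (p x) (p v).
Proof.
move=> cp cp' Tf dT df; rewrite -(diff_lin_comp _ cp' dT) Tf.
have dp : differentiable p x by exact: linear_differentiable.
by rewrite (diff_comp dp df) /= (diff_lin _ cp).
Qed.

(** Meant for the contact form: evaluated on a fixed tangent vector, [dz - p dq] is a constant minus
    a linear function of the base point. *)
Lemma diff_cst_sub E F (g : {linear E -> F}) (c : F) (x v : E) :
  continuous g ->
  differentiable (fun y => c - g y) x /\ 'd (fun y => c - g y) x v = - g v.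
Proof.
move=> cg; have dg : differentiable g x by exact: linear_differentiable.
have dc : differentiable (cst c : E -> F) x by exact: differentiable_cst.
split; first exact: differentiableB.
have /(congr1 (fun h : E -> F => h v)) := diffB dc dg.
by rewrite /= diff_cst (diff_lin _ cg) => ->; exact: add0r.
Qed.

End Differentials.

(** * Charts, and tangent maps read in preferred charts *)

Section Charts.
Context {R : realType} {E : normedModType R} (M : manifold E).

(** The image of a chart is open, being its overlap with itself. Since [chart_inv] is arbitrary off
    that image, chart identities below are only claimed near a point. *)
Lemma near_chart (i : chart M) (x : M) : dom i x ->
  \forall y \near chart_map i x,
    dom i (chart_inv i y) /\ chart_map i (chart_inv i y) = y.
Proof.
move=> ix; have : nbhs (chart_map i x) (chart_map i @` (dom i `&` dom i)).
  by apply: open_nbhs_nbhs; split; [exact: open_overlap|exists x].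
by apply: filterS => _ [y [iy _] <-]; rewrite chart_mapK.
Qed.

Lemma differentiable_smooth_fun (h : M -> R) (i : chart M) (x : M) :
  smooth_fun h -> dom i x ->
  differentiable (h \o chart_inv i) (chart_map i x).
Proof. by move=> sh ix; have [+ _] := sh i 1%N; apply; exists x. Qed.

Lemma differentiable_transition (i j : chart M) (x : M) :
  dom i x -> dom j x ->
  differentiable (chart_map j \o chart_inv i) (chart_map i x).
Proof. by move=> ix jx; have [+ _] := smooth_transition i j 1%N; apply; exists x. Qed.

End Charts.

(** Chain rule: near the point [f] stays in the one chart at [f x], so inserting that chart and its
    inverse between [h] and [f] changes nothing. *)
Lemma differential_comp (R : realType) (E F : normedModType R)
    (M : manifold E) (N : manifold F) (h : N -> R)
    (f : M -> N) (x : M) (v : tangent x) :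
  smooth_fun h ->
  (\forall y \near chart_map (chart_at x) x,
     dom (chart_at (f x)) (f (chart_inv (chart_at x) y))) ->
  differentiable (chart_map (chart_at (f x)) \o f \o chart_inv (chart_at x))
    (chart_map (chart_at x) x) ->
  differential (h \o f) v = differential h (tangent_map f v).
Proof.
set i := chart_at x; set j := chart_at (f x) => sh near_j df.
have fx : (chart_map j \o f \o chart_inv i) (chart_map i x) = chart_map j (f x).
  by rewrite /= chart_mapK //; exact: mem_chart_at.
have dh := differentiable_smooth_fun sh (mem_chart_at (f x)).
rewrite -/j -fx in dh.
have [|_ dE] := @near_diff _ _ _ _ ((h \o f) \o chart_inv i) _ _
  (differentiable_comp df dh).
  by apply: filterS near_j => y jfy /=; rewrite chart_mapK.
rewrite /differential -/i dE (diff_comp df dh) /= -/j.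
by rewrite /tangent_map -/i -/j -fx.
Qed.

(** Serves the bundle projections, whose expressions in preferred charts are linear near the base
    point. *)
Lemma tangent_map_lin (R : realType) (E F : normedModType R)
    (M : manifold E) (N : manifold F) (f : M -> N) (g : {linear E -> F})
    (x : M) (v : tangent x) :
  continuous g ->
  (\forall y \near chart_map (chart_at x) x,
     g y = chart_map (chart_at (f x)) (f (chart_inv (chart_at x) y))) ->
  tangent_map f v = g v.
Proof.
move=> cg gf; have dg := linear_differentiable (chart_map (chart_at x) x) cg.
by rewrite /tangent_map (diff_near_eq _ gf dg) diff_lin.
Qed.

Lemma near_fst (S T : topologicalType) (x : S * T) (P : S -> Prop) :
  (\forall y \near x.1, P y) -> \forall z \near x, P z.1.
Proof. exact: (@cvg_fst _ _ (nbhs x.1) (nbhs x.2)). Qed.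

(** * The pairing of covectors with vectors *)

Section Pairing.
Context {R : realType} {n : nat}.
Implicit Types p v : 'rV[R]_n.

Lemma pairingE p v : pairing p v = (p *m v^T) 0 0.
Proof. by rewrite mxE; apply: eq_bigr => k _; rewrite mxE. Qed.

Lemma pairingDl p p' v : pairing (p + p') v = pairing p v + pairing p' v.
Proof. by rewrite !pairingE mulmxDl mxE. Qed.

Lemma pairingZl a p v : pairing (a *: p) v = a * pairing p v.
Proof. by rewrite !pairingE -scalemxAl mxE. Qed.

Lemma pairing_mulmx p v (A : 'M[R]_n) : pairing p (v *m A) = pairing (p *m A^T) v.
Proof. by rewrite !pairingE trmx_mul mulmxA. Qed.

Lemma pairing_inj p p' : (forall v, pairing p v = pairing p' v) -> p = p'.
Proof.
move=> pp'; apply/rowP => k; have := pp' (delta_mx 0 k).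
by rewrite !pairingE trmx_delta -!colE !mxE.
Qed.

Lemma linear_pairing v : linear (fun p : 'rV[R]_n => pairing p v).
Proof. by move=> a p p'; rewrite pairingDl pairingZl. Qed.

Definition pairing_linear v : {linear 'rV[R]_n -> R} :=
  HB.pack (fun p : 'rV[R]_n => pairing p v)
    (GRing.isLinear.Build _ _ _ _ _ (@linear_pairing v)).

Lemma continuous_pairing v : continuous (pairing_linear v).
Proof.
move=> p; apply: continuous_big => [|k _ p'].
  by move=> x; exact: add_continuous.
apply: (@continuousM _ _ (fun p : 'rV[R]_n => p 0 k) (fun=> v 0 k)).
  exact: coord_continuous.
exact: cst_continuous.
Qed.

End Pairing.

(** * The contact form and its exterior derivative in Darboux coordinates *)

Section ContactGeometry.
Context {R : realType} {n : nat} (Q : manifold 'rV[R]_n).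
Let V : normedModType R := 'rV[R]_n.
Implicit Types (x : ext_cotangent Q).

(** The preferred chart at [x] is built from the one at [x.1], so the chart expression of [fst] is
    again a first projection. *)
Lemma tangent_map_fst x (u : tangent x) :
  tangent_map (M := ext_cotangent Q) (N := cotangent Q) fst u = u.1.
Proof.
apply: (@tangent_map_lin _ _ _ (ext_cotangent Q) (cotangent Q) fst fst) => [y|].
  exact: cvg_fst.
apply: (near_fst (x := chart_map (m := ext_cotangent Q) (chart_at x) x)
  (P := fun y => y = chart_map (m := cotangent Q) (chart_at x.1)
     (chart_inv (m := cotangent Q) (chart_at x.1) y))).
have := near_chart (M := cotangent Q) (mem_chart_at x.1).
by apply: filterS => y [_ ->].
Qed.

Lemma tangent_map_cotangent_proj (w : cotangent Q) (u : tangent w) :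
  tangent_map (@cotangent_proj R n Q) u = u.1.
Proof.
apply: (@tangent_map_lin _ _ _ (cotangent Q) Q (@cotangent_proj R n Q) fst) => [y|].
  exact: cvg_fst.
apply: (near_fst (x := chart_map (m := cotangent Q) (chart_at w) w)
  (P := fun y => y = chart_map (chart_at w.1) (chart_inv (chart_at w.1) y))).
have := near_chart (mem_chart_at w.1).
by apply: filterS => y [_ ->].
Qed.

Lemma tangent_map_fibration x (u : tangent x) :
  tangent_map (@fibration R n Q) u = (u.1.1, u.2).
Proof.
have lg : linear (fun u : (V * V) * R => (u.1.1, u.2) : V * R) by [].
pose g : {linear ((V * V) * R)%type -> (V * R)%type} :=
  HB.pack (fun u : (V * V) * R => (u.1.1, u.2) : V * R)
    (GRing.isLinear.Build _ _ _ _ _ lg).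
apply: (@tangent_map_lin _ _ _ (ext_cotangent Q) (prod_line Q) _ g) => [y|].
  have c1 : {for y, continuous (fst \o fst : (V * V) * R -> V)}.
    by apply: continuous_comp; exact: cvg_fst.
  have c2 : {for y, continuous (snd : (V * V) * R -> R)} by exact: cvg_snd.
  exact: (cvg_pair c1 c2).
have := near_chart (M := ext_cotangent Q) (mem_chart_at x).
by apply: filterS => y [_ yE]; rewrite -[in LHS]yE.
Qed.

Lemma contact_formE x (u : tangent x) :
  contact_form u = u.2 - pairing x.1.2 u.1.1.
Proof.
have cf : continuous (snd : (V * V) * R -> R) by move=> y; exact: cvg_snd.
rewrite /contact_form /pullback /canonical_one_form tangent_map_fst.
rewrite tangent_map_cotangent_proj.
congr (_ - _).
exact (congr1 (fun g : (V * V) * R -> R => g u) (diff_lin (f := snd) _ cf)).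
Qed.

(** The Darboux formula holds in every chart because covector components change by the transpose of
    the Jacobian acting on vectors. Arbitrary charts matter: [ext_diff] at a point uses its chart at
    nearby points, whose preferred charts may differ. *)
Lemma in_chart_contact_form x (i : chart Q) (y v : (V * V) * R) :
  dom i x.1.1 -> chart_map (m := ext_cotangent Q) i x = y ->
  in_chart (@contact_form R n Q) i y v = v.2 - pairing y.1.2 v.1.1.
Proof.
move=> ix <- {y}; set y := chart_map (m := ext_cotangent Q) i x; set c := chart_at x.1.1.
have cx : dom c x.1.1 := mem_chart_at x.1.1.
have xy : chart_inv (m := ext_cotangent Q) i y = x.
  by apply: (chart_mapK (m := ext_cotangent Q)); split.
rewrite /in_chart contact_formE xy.
set T := chart_map (m := ext_cotangent Q) _ \o _.
have dT : differentiable T y by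
  apply: (differentiable_transition (M := ext_cotangent Q)); split.
(* The change of coordinates [T] covers the transition map of [Q] and fixes z. *)
have T1 : ('d T y v).1.1 = 'd (transition i c) (chart_map i x.1.1) v.1.1.
  apply: (@diff_semiconj _ _ _ _ _ T (transition i c) (fst \o fst) (fst \o fst)) => //.
  - move=> z; apply: continuous_comp; exact: cvg_fst.
  - move=> z; apply: continuous_comp; exact: cvg_fst.
  - exact: transition_diff.
have T2 : ('d T y v).2 = v.2.
  have cs : continuous (snd : (V * V) * R -> R) by move=> z; exact: cvg_snd.
  have -> : v.2 = 'd (id : R -> R) (y.2) v.2 by rewrite diff_val.
  by apply: (@diff_semiconj _ _ _ _ _ T id snd snd).
rewrite T1 T2; congr (_ - _).
by rewrite -mulmx_jacobian pairing_mulmx.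
Qed.

Lemma diff_in_chart_contact_form x (u v : tangent x) :
  'd (fun y => in_chart (@contact_form R n Q) (chart_at x) y v)
    (chart_map (chart_at x) x) u = - pairing u.1.2 v.1.1.
Proof.
pose g : {linear ((V * V) * R)%type -> R} := pairing_linear v.1.1 \o (snd \o fst).
have cg : continuous g.
  move=> y; apply: continuous_comp; last exact: continuous_pairing.
  by apply: continuous_comp; [exact: cvg_fst|exact: cvg_snd].
have [dg dE] := diff_cst_sub v.2 (chart_map (m := ext_cotangent Q) (chart_at x) x) u cg.
rewrite -[RHS]dE; apply: diff_near_eq dg.
have := near_chart (M := ext_cotangent Q) (mem_chart_at x).
apply: filterS => y [[[iy _] _] yE].
by rewrite (in_chart_contact_form _ iy yE).
Qed.

(** The right-hand side is the two-form [dq_k /\ dp_k], summed over k. *)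
Lemma ext_diff_contact_form x (u v : tangent x) :
  ext_diff (@contact_form R n Q) u v =
  pairing v.1.2 u.1.1 - pairing u.1.2 v.1.1.
Proof. by rewrite /ext_diff !diff_in_chart_contact_form opprK addrC. Qed.

(** * The tangent map of a one-form, its exterior derivative, and the lift to the extended bundle *)

Context (a : one_form Q) (smooth_a : smooth_one_form a).

(** The second component lists the components of [a] in the single chart [i], whereas [a] itself
    uses the preferred chart of each point. *)
Let section_chart (i : chart Q) : V -> V * V :=
  chart_map (m := cotangent Q) i \o one_form_section a \o chart_inv i.

Let differentiable_section i q : dom i q ->
  differentiable (section_chart i) (chart_map i q).
Proof.
(* Charts of [cotangent Q] are indexed by those of [Q], so [i] serves on both sides. *)
move=> iq; have [_ /(_ 1%N) [ds _]] := smooth_a i i.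
by apply: ds; exists q.
Qed.

Lemma tangent_map_section_fst (q : Q) (u : tangent q) :
  (tangent_map (one_form_section a) u).1 = u.
Proof.
have iq := mem_chart_at q; have ds := differentiable_section iq.
have cf : continuous (fst : V * V -> V) by move=> y; exact: cvg_fst.
rewrite -[LHS](diff_lin_comp (g := fst) u cf ds).
have uE : 'd (id : V -> V) (chart_map (chart_at q) q) u = u by rewrite diff_val.
rewrite -[RHS]uE.
apply: diff_near_eq; last exact: ex_diff.
by have := near_chart iq; apply: filterS => y [_ yE]; exact: esym.
Qed.

Let in_chart_one_form i q (y v : V) : dom i q -> chart_map i q = y ->
  in_chart (fun q' w => pairing (a q') w : R) i y v =
  pairing (section_chart i y).2 v.
Proof.
move=> iq <-; rewrite /in_chart /section_chart /= chart_mapK //.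
by rewrite -mulmx_jacobian pairing_mulmx.
Qed.

(** Both sides differentiate the components of [a] in the chart at [q]. Closedness thereby becomes
    symmetry of the p part of the tangent map. *)
Lemma ext_diff_one_form (q : Q) (u v : tangent q) :
  ext_diff (fun q' w => pairing (a q') w : R) u v =
  pairing (tangent_map (one_form_section a) u).2 v -
  pairing (tangent_map (one_form_section a) v).2 u.
Proof.
have iq := mem_chart_at q; have ds := differentiable_section iq.
suff dE (u' v' : V) : 'd (fun y => in_chart (fun q' w => pairing (a q') w : R)
    (chart_at q) y v') (chart_map (chart_at q) q) u' =
    pairing ('d (section_chart (chart_at q)) (chart_map (chart_at q) q) u').2 v'.
  by rewrite /ext_diff !dE.
pose g : {linear (V * V)%type -> R} := pairing_linear v' \o snd.
have cg : continuous g.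
  by move=> y; apply: continuous_comp; [exact: cvg_snd|exact: continuous_pairing].
rewrite -[RHS](diff_lin_comp u' cg ds); apply: diff_near_eq.
  have := near_chart iq; apply: filterS => y [iy yE].
  by rewrite (in_chart_one_form _ iy yE).
by apply: differentiable_comp => //; exact: linear_differentiable.
Qed.

Let lift_chart i : V * R -> (V * V) * R :=
  chart_map (m := ext_cotangent Q) i \o lift_section a \o
  chart_inv (m := prod_line Q) i.

Let differentiable_lift i (b : prod_line Q) : dom i b.1 ->
  differentiable (lift_chart i) (chart_map (m := prod_line Q) i b).
Proof.
move=> ib; have cf : continuous (fst : V * R -> V) by move=> y; exact: cvg_fst.
have cs : continuous (snd : V * R -> R) by move=> y; exact: cvg_snd.
apply: (@differentiable_pair _ _ _ _ (section_chart i \o fst) snd).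
  have df := linear_differentiable (chart_map (m := prod_line Q) i b) (f := fst) cf.
  exact: (differentiable_comp df (differentiable_section ib)).
exact: (linear_differentiable (f := snd)).
Qed.

(** In charts the lift is the product of [section_chart] with the identity of the z line. *)
Lemma tangent_map_lift (b : prod_line Q) (u : tangent b) :
  tangent_map (lift_section a) u =
  (tangent_map (M := Q) (N := cotangent Q) (one_form_section a) (x := b.1) u.1, u.2).
Proof.
have ib := mem_chart_at b.1; have dl := differentiable_lift ib.
apply: injective_projections.
  apply: (@diff_semiconj _ _ _ _ _ _ (section_chart (chart_at b.1)) fst fst) => //.
  - by move=> y; exact: cvg_fst.
  - by move=> y; exact: cvg_fst.
  - exact: differentiable_section.
have -> : u.2 = 'd (id : R -> R) (b.2) u.2 by rewrite diff_val.
apply: (@diff_semiconj _ _ _ _ _ _ id snd snd) => //.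
- by move=> y; exact: cvg_snd.
- by move=> y; exact: cvg_snd.
Qed.

Lemma differential_lift (h : ext_cotangent Q -> R) (b : prod_line Q) (u : tangent b) :
  smooth_fun h ->
  differential (h \o lift_section a) u = differential h (tangent_map (lift_section a) u).
Proof.
move=> sh; apply: differential_comp => //.
  have := near_chart (M := prod_line Q) (mem_chart_at b).
  by apply: filterS => y [[iy _] _].
exact: (differentiable_lift (mem_chart_at b.1)).
Qed.

End ContactGeometry.

Theorem theorem3p1 (R : realType) (n : nat) (Q : manifold 'rV[R]_n)
  (Reeb : vector_field (ext_cotangent Q))
  (hReeb : is_reeb_field Reeb)
  (H : ext_cotangent Q -> R) (hH : smooth_fun H)
  (XH : vector_field (ext_cotangent Q))
  (hXH : is_contact_hamiltonian_field Reeb H XH)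
  (gamma_hat : one_form Q)
  (hsmooth : smooth_one_form gamma_hat)
  (hclosed : closed_one_form gamma_hat) :
  let gamma := lift_section gamma_hat in
  related gamma (projected_field XH gamma_hat) XH <->
  (forall (b : prod_line Q) (u : tangent b),
     differential (H \o gamma) u =
     pullback gamma
       (fun x v => differential H (Reeb x) * contact_form v) u).
Proof.
move=> gamma.
pose D q (u : tangent q) := (tangent_map (one_form_section gamma_hat) u).2.
have Dsym q (u v : tangent q) : pairing (D q u) v = pairing (D q v) u.
  by apply/subr0_eq; rewrite -ext_diff_one_form.
(* The q and z components agree automatically, as [gamma] is a section of the fibration; only the p
   component carries a condition. *)
have relE b : tangent_map gamma (projected_field XH gamma_hat b) = XH (gamma b) <->
    D b.1 (XH (gamma b)).1.1 = (XH (gamma b)).1.2.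
  rewrite /projected_field tangent_map_lift // tangent_map_fibration.
  case: (XH (gamma b)) => [[q p] z] /=.
  rewrite [tangent_map _ _]surjective_pairing tangent_map_section_fst // -/(D b.1 q).
  by split=> [[]|->].
(* The two sides differ by [deta(X_H, Tgamma u)], by the equation of [XH] tested on [Tgamma u];
   [Dsym] then moves D onto the q part of [XH]. *)
have eqE b (u : tangent b) : differential (H \o gamma) u =
     pullback gamma (fun x v => differential H (Reeb x) * contact_form v) u <->
    pairing (D b.1 (XH (gamma b)).1.1) u.1 = pairing (XH (gamma b)).1.2 u.1.
  rewrite differential_lift // /pullback -/gamma.
  have [_ /(_ (tangent_map gamma u))] := hXH (gamma b).
  rewrite ext_diff_contact_form tangent_map_lift //=.
  rewrite tangent_map_section_fst // -/(D b.1 u.1) Dsym => dE.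
  by split=> /eqP; rewrite -subr_eq0 (dE, esym dE) subr_eq0 => /eqP.
split=> [rel b u|eq b].
  by apply/eqE; congr pairing; apply/relE.
apply/relE; apply: pairing_inj => v.
(* The criterion [eqE] sees only the [Q] component of a test vector, so z is filled with 0. *)
by have /eqE := eq b (v, 0).
Qed.
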